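(* Let $T_1$ and $T_2$ be par-operator gen-semigroups, let $\theta\subseteq T_1\times T_2$, let $S_1$ and $S_2$ be a $T_1$-space and a $T_2$-space, respectively, let $\phi\in\operatorname{Iso}_\theta(S_1,S_2)$ and let $\phi^{-1}$ be the inverse map of $\phi$. Then $\phi^{-1}\in\operatorname{Iso}_{\theta^{-1}}(S_2,S_1)$, where $\theta^{-1}=\{(g,f):(f,g)\in\theta\}$.
   Context: A partial function $f$ of $n$ variables from $D^n$ to $D$ is a function from a (possibly empty) subset of $D^n$ (its domain of definition) to $D$; $f(x_1,\dots,x_m)$ is well-defined if $(x_1,\dots,x_m)$ lies in the domain of definition (so $m=n$). For an $n$-variable $f$ and partial functions $g_i$ of $n_i$ variables ($i=1,\dots,n$), the composite $f\circ(g_1,\dots,g_n)$ is the partial function of $n_1+\cdots+n_n$ variables obtained by substituting $g_1,\dots,g_n$, evaluated on consecutive disjoint blocks of variables, into $f$ (defined where all the involved values are defined). A par-operator gen-semigroup on a set $D$ is a set $T$ of partial functions $D^n\to D$ ($n\in\mathbb{Z}^+$ arbitrary) such that for every $n$-variable $f\in T$ and $g_1,\dots,g_n\in T$, $f\circ(g_1,\dots,g_n)$ is a restriction of some element of $T$. For $U\subseteq D$, $\langle U\rangle_T$ is the set of all well-defined values $f(u_1,\dots,u_n)$ with $f\in T$, $u_i\in U$, $n\in\mathbb{Z}^+$; such sets are the $T$-spaces. Let $T_1,T_2$ be par-operator gen-semigroups on $D_1,D_2$ and $\theta\subseteq T_1\times T_2$. For $A\subseteq D_2$, ''$\theta|_A$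 is a map'' means: for all $(f,g_1),(f,g_2)\in\theta$, $n\in\mathbb{Z}^+$ and $(a_1,\dots,a_n)\in A^n$, either neither $g_1(a_1,\dots,a_n)$ nor $g_2(a_1,\dots,a_n)$ is well-defined, or both are and they are equal. For $f\in\operatorname{Dom}\theta$, $\theta(f)(b_1,\dots,b_n)$ is well-defined if for all $g$ with $(f,g)\in\theta$ the value $g(b_1,\dots,b_n)$ is well-defined and is the same; $\theta(f)(b_1,\dots,b_n)$ denotes that value. A map $\phi$ from a $T_1$-space $S$ to a $T_2$-space is a $\theta$-morphism if (i) $\theta|_{\operatorname{Im}\phi}$ is a map, and (ii) for all $n\in\mathbb{Z}^+$, $(a_1,\dots,a_n)\in S^n$ and $f\in\operatorname{Dom}\theta$, either neither $f(a_1,\dots,a_n)$ nor $\theta(f)(\phi(a_1),\dots,\phi(a_n))$ is well-defined, or both are well-defined and $\phi(f(a_1,\dots,a_n))=\theta(f)(\phi(a_1),\dots,\phi(a_n))$. A $\theta$-isomorphism is a bijective $\theta$-morphism, and $\operatorname{Iso}_\theta(S_1,S_2)$ is the set of all $\theta$-isomorphisms from $S_1$ to $S_2$. *)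

(* Defs.v *)
From mathcomp Require Import all_boot.
From mathcomp Require Export boolp classical_sets.

Set Implicit Arguments.
Unset Strict Implicit.
Unset Printing Implicit Defensive.

Local Open Scope classical_set_scope.

(* [None] encodes a point outside the domain of definition. *)
Record parfun (D : Type) := ParFun {
  arity : nat;
  arity_gt0 : (0 < arity)%N;
  parfun_val : arity.-tuple D -> option D }.

(* The value of f at a list of any length: a list whose length is not the
   arity of f lies outside the domain of definition. *)
Definition peval (D : Type) (f : parfun D) (x : seq D) : option D :=
  obind (@parfun_val D f) (insub x).

Section Composite.
Variables (D : Type) (f : parfun D) (g : (arity f).-tuple (parfun D)).

Definition comp_arity : nat := sumn (map (@arity D) g).

Lemma comp_arity_gt0 : (0 < comp_arity)%N.
Proof.
rewrite /comp_arity; case: g => -[|h s] /= /eqP sg.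
  by have := arity_gt0 f; rewrite -sg.
by rewrite addn_gt0 arity_gt0.
Qed.

(* The values of g_1, ..., g_n on the consecutive blocks of x. *)
Definition block_values (x : seq D) : seq (option D) :=
  [seq peval p.1 p.2 | p <- zip g (reshape (map (@arity D) g) x)].

Definition comp_val (x : comp_arity.-tuple D) : option D :=
  let vs := block_values x in
  if all isSome vs then peval f (pmap id vs) else None.

Definition pcomp : parfun D := ParFun comp_arity_gt0 comp_val.

End Composite.

(* Restriction is inclusion of graphs; in particular an empty partial function
   is a restriction of every partial function, whatever the arities. *)
Definition restriction_of (D : Type) (h k : parfun D) : Prop :=
  forall (x : seq D) (y : D), peval h x = Some y -> peval k x = Some y.

Definition par_operator_gen_semigroup (D : Type) (T : set (parfun D)) : Prop :=
  forall (f : parfun D) (g : (arity f).-tuple (parfun D)),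
    T f -> (forall i, T (tnth g i)) ->
    exists2 k, T k & restriction_of (pcomp g) k.

Definition gen_space (D : Type) (T : set (parfun D)) (U : set D) : set D :=
  [set y | exists (f : parfun D) (n : nat) (u : n.-tuple D),
    [/\ T f, (0 < n)%N, (forall i, U (tnth u i)) & peval f u = Some y]].

Definition is_space (D : Type) (T : set (parfun D)) (S : set D) : Prop :=
  exists U : set D, S = gen_space T U.

Section Morphisms.
Variables D1 D2 : Type.
Implicit Type theta : set (parfun D1 * parfun D2).

Definition map_on theta (A : set D2) : Prop :=
  forall (f : parfun D1) (g1 g2 : parfun D2), theta (f, g1) -> theta (f, g2) ->
  forall (n : nat) (a : n.-tuple D2), (0 < n)%N -> (forall i, A (tnth a i)) ->
    (peval g1 a = None /\ peval g2 a = None) \/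
    (exists v : D2, peval g1 a = Some v /\ peval g2 a = Some v).

(* theta(f)(b) is well-defined and equal to v; theta.`1 is Dom theta. *)
Definition theta_value theta (f : parfun D1) (b : seq D2) (v : D2) : Prop :=
  theta.`1 f /\ forall g : parfun D2, theta (f, g) -> peval g b = Some v.

(* In the second disjunct, y is f(a) viewed as an element of S1. *)
Definition theta_morphism theta (S1 : set D1) (S2 : set D2) (phi : S1 -> S2)
    : Prop :=
  map_on theta (range (fun x : S1 => val (phi x))) /\
  forall (n : nat) (a : n.-tuple S1) (f : parfun D1),
    (0 < n)%N -> theta.`1 f ->
    let fa := peval f [seq val x | x <- a] in
    let thfa := theta_value theta f [seq val (phi x) | x <- a] in
    (fa = None /\ ~ (exists v : D2, thfa v)) \/
    (exists y : S1, fa = Some (val y) /\ thfa (val (phi y))).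

Definition Iso theta (S1 : set D1) (S2 : set D2) : set (S1 -> S2) :=
  [set phi | theta_morphism theta phi /\ bijective phi].

End Morphisms.

Arguments Iso {D1 D2} theta S1 S2 _.

(* Main.v *)
Require Import Defs.
From mathcomp Require Import all_boot.
From mathcomp Require Import boolp classical_sets.
Local Open Scope classical_set_scope.

(** The definition of a theta-morphism treats the two sides asymmetrically:
    the domain side carries single functions [f], the target side the value
    [theta(f)] on which all partners of [f] must agree.  The theorem holds
    because this asymmetry is only apparent.  A map [phi] is a theta-morphism
    iff it intertwines every single pair [(f, g)] of [theta]: [f(a)] and
    [g(phi(a))] are both undefined, or [f(a)] is some [y] in [S1] and
    [g(phi(a))] is [phi(y)] (lemma [theta_morphismP]).

    Given a morphism, condition (i) makes all partners of [f] agree on the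
    tuple [phi(a)], so that [theta(f)(phi(a))] is defined exactly when any one of
    them is, and then equals its value.  Conversely, if every pair is intertwined, then
    all partners of [f] have the value dictated by [f(a)], so they agree.

    For a bijective [phi], intertwining [(f, g)] along [phi] is the same as
    intertwining [(g, f)] along the inverse of [phi]: substitute
    [a = phi_inv(b)] (lemma [intertwines_inv]). *)

(** The option [o] is the common outcome of both evaluations, [None] standing
    for undefined; this merges the two alternatives in the definition of a
    morphism and makes the condition transportable by [omap]. *)
Definition intertwines (D1 D2 : Type) (theta : set (parfun D1 * parfun D2))
    (S1 : set D1) (S2 : set D2) (phi : S1 -> S2) : Prop :=
  forall (f : parfun D1) (g : parfun D2), theta (f, g) ->
  forall (n : nat) (a : n.-tuple S1), (0 < n)%N ->
  exists o : option S1,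
    peval f [seq val x | x <- a] = omap val o /\
    peval g [seq val (phi x) | x <- a] = omap (fun y => val (phi y)) o.
Arguments intertwines {D1 D2} theta {S1 S2} phi.

(** Condition (i) quantifies over tuples with entries in the image of [phi],
    whereas intertwining speaks of images of tuples. *)
Lemma tuple_in_range (A B : Type) (h : A -> B) (n : nat) (b : n.-tuple B) :
  (forall i, range h (tnth b i)) ->
  exists a : n.-tuple A, val b = [seq h x | x <- a].
Proof.
move=> bh.
have /choice[c hc] : forall i, exists x, h x = tnth b i.
  by move=> i; have [x _ hx] := bh i; exists x.
exists (mktuple c); rewrite -[RHS]/(val (map_tuple h (mktuple c))).
by congr val; apply: eq_from_tnth => i; rewrite tnth_map tnth_mktuple hc.
Qed.

(** [f(a)] alone determines the common outcome, because [S1] embeds in [D1];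
    hence all partners of [f] take the same value at [phi(a)]. *)
Lemma intertwines_partners (D1 D2 : Type)
    (theta : set (parfun D1 * parfun D2)) (S1 : set D1) (S2 : set D2)
    (phi : S1 -> S2) (f : parfun D1) (g1 g2 : parfun D2)
    (n : nat) (a : n.-tuple S1) :
  intertwines theta phi -> theta (f, g1) -> theta (f, g2) -> (0 < n)%N ->
  peval g1 [seq val (phi x) | x <- a] = peval g2 [seq val (phi x) | x <- a].
Proof.
move=> phiI fg1 fg2 n0.
have [o1 [fo1 ->]] := phiI _ _ fg1 _ a n0.
have [o2 [fo2 ->]] := phiI _ _ fg2 _ a n0.
by congr omap; apply: (inj_omap val_inj); rewrite -fo1.
Qed.
Arguments intertwines_partners {D1 D2 theta S1 S2 phi f g1 g2 n} a.

Lemma theta_morphismP (D1 D2 : Type) (theta : set (parfun D1 * parfun D2))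
    (S1 : set D1) (S2 : set D2) (phi : S1 -> S2) :
  theta_morphism theta phi <-> intertwines theta phi.
Proof.
split=> [[thmap phiM] f g fg n a n0|phiI].
  have [[fa nth]|[y [fa [_ /(_ g fg) gy]]]] := phiM n a f n0 (ex_intro _ g fg);
    last by exists (Some y).
  exists None; split=> //=; case gv: peval => [v|//]; exfalso; apply: nth.
  (* A value of g would be shared by all partners of f, hence be a value of
     theta(f), although f(a) is undefined. *)
  exists v; split=> [|g' fg']; first by exists g.
  have im i : range (fun x : S1 => val (phi x))
      (tnth (map_tuple (fun x => val (phi x)) a) i).
    by rewrite tnth_map; exists (tnth a i).
  by have [[]|[w []]] := thmap _ _ _ fg fg' _ _ n0 im; rewrite /= gv // => -[->].
split=> [f g1 g2 fg1 fg2 n b n0 /tuple_in_range[a ->]|n a f n0 [g fg]].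
  rewrite (intertwines_partners a phiI fg1 fg2 n0).
  by case: peval => [v|]; [right; exists v|left].
have [[y|] [fa ga]] := phiI _ _ fg _ a n0; [right; exists y|left]; split=> //.
  split=> [|g' fg']; first by exists g.
  by rewrite (intertwines_partners a phiI fg' fg n0).
by move=> [v [_ /(_ g fg)]]; rewrite ga.
Qed.

Lemma intertwines_inv (D1 D2 : Type) (theta : set (parfun D1 * parfun D2))
    (S1 : set D1) (S2 : set D2) (phi : S1 -> S2) (phi_inv : S2 -> S1) :
  cancel phi phi_inv -> cancel phi_inv phi ->
  intertwines theta phi -> intertwines (theta^-1)%relation phi_inv.
Proof.
move=> phiK phi_invK phiI g f fg n b n0.
have [o [fo go]] := phiI f g fg n (map_tuple phi_inv b) n0.
exists (omap phi o); split.
  have -> : [seq val x | x <- b] =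
      [seq val (phi x) | x <- map_tuple phi_inv b].
    by rewrite -map_comp; apply: eq_map => x /=; rewrite phi_invK.
  by rewrite go; case: o {fo go}.
rewrite (map_comp val phi_inv) fo.
by case: o {fo go} => //= y; rewrite phiK.
Qed.
Arguments intertwines_inv {D1 D2 theta S1 S2 phi phi_inv}.

Theorem proposition9p6p2 (D1 D2 : Type)
    (T1 : set (parfun D1)) (T2 : set (parfun D2))
    (hT1 : par_operator_gen_semigroup T1)
    (hT2 : par_operator_gen_semigroup T2)
    (theta : set (parfun D1 * parfun D2)) (htheta : theta `<=` T1 `*` T2)
    (S1 : set D1) (S2 : set D2)
    (hS1 : is_space T1 S1) (hS2 : is_space T2 S2)
    (phi : S1 -> S2) (hphi : Iso theta S1 S2 phi)
    (phi_inv : S2 -> S1)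
    (phiK : cancel phi phi_inv) (phi_invK : cancel phi_inv phi) :
  Iso (theta^-1)%relation S2 S1 phi_inv.
Proof.
have [/theta_morphismP phiI _] := hphi.
split; last by exists phi.
apply/theta_morphismP.
exact: intertwines_inv phiK phi_invK phiI.
Qed.
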